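(* Let $T,U\in\mathcal{GB}(H)$, and let $S_{T\Lambda\Gamma U}$ be the frame operator for a pair consisting of a $(T,T)$-controlled $g$-fusion Bessel sequence $\Lambda_T=\{(W_j,\Lambda_j,w_j)\}_{j\in J}$ and a $(U,U)$-controlled $g$-fusion Bessel sequence $\Gamma_U=\{(V_j,\Gamma_j,v_j)\}_{j\in J}$ in $H$, with bounds $D_1$ and $D_2$, respectively. Assume $\lambda\in(0,1)$ is such that $$\|f-S_{T\Lambda\Gamma U}f\|\le\lambda\|f\|\quad\text{for all } f\in H.$$ Then $\Lambda_T$ is a $(T,T)$-controlled $g$-fusion frame for $H$ and $\Gamma_U$ is a $(U,U)$-controlled $g$-fusion frame for $H$.
   Context: $H$ is a separable Hilbert space, $J\subset\mathbb{Z}$, $\{H_j\}_{j\in J}$ is a collection of Hilbert spaces, $W_j,V_j\subset H$ are closed subspaces, $w_j,v_j>0$ are weights, and $\Lambda_j,\Gamma_j\in\mathcal{B}(H,H_j)$ (bounded linear operators). $\mathcal{GB}(H)$ is the set of bounded linear operators on $H$ having a bounded inverse. $P_M$ is the orthogonal projection onto a closed subspace $M$. For $R\in\mathcal{GB}(H)$, a family $\{(M_j,\Theta_j,u_j)\}_{j\in J}$ ($M_j\subset H$ closed subspaces, $\Theta_j\in\mathcal{B}(H,H_j)$, $u_j>0$) is an $(R,R)$-controlled $g$-fusion frame for $H$ if there are $0<a\le b<\infty$ with $$a\|f\|^2\le\sum_{j\in J}u_j^2\langle\Theta_jP_{M_j}Rf,\Theta_jP_{M_j}Rf\rangle\le b\|f\|^2\quad\text{for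 all } f\in H;$$ it is an $(R,R)$-controlled $g$-fusion Bessel sequence with bound $b$ if the right-hand inequality holds. The frame operator of the pair $\Lambda_T,\Gamma_U$ is the bounded operator $$S_{T\Lambda\Gamma U}f=\sum_{j\in J}v_jw_jT^*P_{W_j}\Lambda_j^*\Gamma_jP_{V_j}Uf,\quad f\in H.$$ *)

(* Defs.v *)
From HB Require Import structures.
From mathcomp Require Import all_boot all_order all_algebra.
From mathcomp Require Import finmap complex.
From mathcomp Require Import all_classical all_reals all_analysis.
From mathcomp.analysis.showcase Require summability.
Import Order.TTheory GRing.Theory Num.Theory numFieldNormedType.Exports.

Set Implicit Arguments.
Unset Strict Implicit.
Unset Printing Implicit Defensive.

Local Open Scope classical_set_scope.
Local Open Scope ring_scope.

(* The source leaves the scalars of its Hilbert spaces implicit; both the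
   real and the complex case are covered. *)
Variant scalar_kind := RealScalars | ComplexScalars.

Definition scalars (R : realType) (k : scalar_kind) : numFieldType :=
  match k with RealScalars => R | ComplexScalars => R[i] end.

Definition conj_scalar (R : realType) (k : scalar_kind) :
    scalars R k -> scalars R k :=
  match k with RealScalars => id | ComplexScalars => @conjc R end.

Definition of_real (R : realType) (k : scalar_kind) : R -> scalars R k :=
  match k with RealScalars => id | ComplexScalars => fun x => x%:C%C end.

Definition re_scalar (R : realType) (k : scalar_kind) : scalars R k -> R :=
  match k with RealScalars => id | ComplexScalars => @complex.Re R end.

Arguments conj_scalar {R} k.
Arguments of_real {R} k.
Arguments re_scalar {R k}.

Section ConjScalar.
Context (R : realType) (k : scalar_kind).

Fact conj_scalar_is_zmod_morphism : zmod_morphism (@conj_scalar R k).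
Proof. by case: k => //=; exact: rmorphB. Qed.

Fact conj_scalar_is_monoid_morphism : monoid_morphism (@conj_scalar R k).
Proof. by case: k => //=; split; [exact: rmorph1|exact: rmorphM]. Qed.

HB.instance Definition _ := GRing.isZmodMorphism.Build
  (scalars R k) (scalars R k) (@conj_scalar R k) conj_scalar_is_zmod_morphism.
HB.instance Definition _ := GRing.isMonoidMorphism.Build
  (scalars R k) (scalars R k) (@conj_scalar R k) conj_scalar_is_monoid_morphism.

End ConjScalar.

(* The inner product is linear in its first argument and conjugate-linear in
   the second one. *)
HB.mixin Record CompleteNormedModule_isHilbert (R : realType) (k : scalar_kind)
    (H : Type) of CompleteNormedModule (scalars R k) H := {
  inner : {dot H for @conj_scalar R k};
  inner_norm : forall x : H, `|x| ^+ 2 = inner x x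
}.

#[short(type="hilbertType")]
HB.structure Definition Hilbert (R : realType) (k : scalar_kind) :=
  {H of CompleteNormedModule_isHilbert R k H
      & CompleteNormedModule (scalars R k) H}.

Notation "'<[' x , y ]>" := (inner x y) (format "<[ x ,  y ]>") : ring_scope.

Section HilbertOperators.
Context {R : realType} {k : scalar_kind}.
Implicit Types H G : hilbertType R k.

(* The norm of a [hilbertType] takes its values in [scalars R k]. *)
Definition rnorm H (x : H) : R := re_scalar `|x|.

Definition separable H := exists2 D : set H, countable D & dense D.

Definition bounded_op H G (A : {linear H -> G}) :=
  exists M : R, forall x, rnorm (A x) <= M * rnorm x.

Definition GB H (A : {linear H -> H}) :=
  bounded_op A /\
  exists B : {linear H -> H}, [/\ bounded_op B, cancel A B & cancel B A].

Definition closed_subspace H (M : set H) :=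
  [/\ closed M, M 0 &
      forall (a : scalars R k) (x y : H), M x -> M y -> M (a *: x + y)].

(* For a closed subspace [M], [proj M x] is the unique point y of M with
   x - y orthogonal to M; in general it is a default value if no y exists. *)
Definition proj H (M : set H) (x : H) : H :=
  xget 0 [set y | M y /\ forall z, M z -> <[x - y, z]> = 0].

(* For a bounded operator [A], [adj A y] is the unique x that represents the
   functional z |-> <A z, y>; in general it is a default value if no x exists. *)
Definition adj H G (A : {linear H -> G}) (y : G) : H :=
  xget 0 [set x | forall z, <[A z, y]> = <[z, x]>].

Section Families.
Context {H : hilbertType R k} {I : choiceType} {HI : I -> hilbertType R k}.
Implicit Types (T U : {linear H -> H}) (M W V : I -> set H) (b : R).
Implicit Types (Theta Lambda Gamma : forall j, {linear H -> HI j}).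
Implicit Types (u w v : I -> R).

Definition weighted_family M Theta u :=
  forall j, [/\ closed_subspace (M j), bounded_op (Theta j) & 0 < u j].

Definition controlled_sum T M Theta u (f : H) : \bar R :=
  \esum_(j in [set: I])
    (u j ^+ 2 *
     re_scalar <[Theta j (proj (M j) (T f)), Theta j (proj (M j) (T f))]>)%:E.

Definition controlled_gfusion_bessel T M Theta u b :=
  [/\ weighted_family M Theta u, 0 < b &
      forall f, (controlled_sum T M Theta u f <= (b * rnorm f ^+ 2)%:E)%E].

Definition controlled_gfusion_frame T M Theta u :=
  weighted_family M Theta u /\
  exists a b : R, [/\ 0 < a, a <= b & forall f,
    ((a * rnorm f ^+ 2)%:E <= controlled_sum T M Theta u f)%E /\
    (controlled_sum T M Theta u f <= (b * rnorm f ^+ 2)%:E)%E].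

(* [summability.sum] is the limit of the net of finite partial sums, that is,
   the sum of an unconditionally convergent series. *)
Definition frame_operator T W Lambda w U V Gamma v (f : H) : H :=
  summability.sum (fun j : I =>
    of_real k (v j * w j) *:
    adj T (proj (W j) (adj (Lambda j) (Gamma j (proj (V j) (U f)))))).

End Families.
End HilbertOperators.

(* Main.v *)
(* Let t_j be the terms of the frame operator S.  Since the projections are
   self-adjoint, Re <t_j, g> is at most
     (v_j |Gamma_j P_(V_j) U f|) (w_j |Lambda_j P_(W_j) T g|),
   so by AM-GM, for all s > 0,
     2 Re <S f, g> <= s sum_U(f) + s^-1 sum_T(g),
   where sum_T and sum_U are the two controlled sums.  The same estimate for
   finite partial sums, with g the partial sum itself and s = D1, gives the
   unconditional Cauchy criterion for the series.  The hypothesis yields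
   (1 - lambda) |f|^2 <= Re <S f, f>.  Taking g = f and s = (1 - lambda) / D2,
   the Bessel bound sum_U(f) <= D2 |f|^2 leaves
   (1 - lambda)^2 / D2 |f|^2 <= sum_T(f); the other bound is symmetric. *)
Require Import Defs.
From HB Require Import structures.
From mathcomp Require Import all_boot all_order all_algebra.
From mathcomp Require Import all_classical all_reals all_analysis.
From mathcomp Require Import finmap complex ring lra.
Import Order.TTheory GRing.Theory Num.Theory numFieldNormedType.Exports.
Local Open Scope classical_set_scope.
Local Open Scope ring_scope.

(** * Real parts and real embeddings, uniformly for both kinds of scalars *)

Section Scalars.
Context {R : realType} {k : scalar_kind}.
Implicit Types (a b : scalars R k) (x y : R).

Lemma re_scalarD a b : re_scalar (a + b) = re_scalar a + re_scalar b.
Proof. by case: k a b => //= -[? ?] [? ?]. Qed.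

Lemma re_scalar0 : re_scalar (0 : scalars R k) = 0.
Proof. by case: k. Qed.

Lemma of_real0 : of_real k 0 = 0 :> scalars R k.
Proof. by case: k. Qed.

Lemma re_scalarM x a : re_scalar (of_real k x * a) = x * re_scalar a.
Proof. by case: k a => //= -[? ?] /=; rewrite mul0r subr0. Qed.

Lemma re_conj_scalar a : re_scalar (conj_scalar k a) = re_scalar a.
Proof. by case: k a => //= -[]. Qed.

Lemma of_realK : cancel (of_real k) (@re_scalar R k).
Proof. by case: k. Qed.

Lemma of_realX x n : of_real k (x ^+ n) = of_real k x ^+ n.
Proof. by case: k => //=; rewrite rmorphXn. Qed.

Lemma ltr_of_real x y : (of_real k x < of_real k y) = (x < y).
Proof. by case: k => //=; rewrite ltcR. Qed.

Lemma of_real_re a : 0 <= a -> of_real k (re_scalar a) = a.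
Proof. by case: k a => //= -[x y]; rewrite lecE /= => /andP[/eqP ->]. Qed.

(** The product is the squared modulus of [a]. This recovers full orthogonality from the vanishing
    of real parts. *)
Lemma re_conj_mulr_eq0 a : re_scalar (conj_scalar k a * a) = 0 -> a = 0.
Proof.
case: k a => [a /eqP|[x y] /= /eqP]; first by rewrite /= mulf_eq0 orbb => /eqP.
rewrite mulNr opprK -!expr2 paddr_eq0 ?sqr_ge0// !sqrf_eq0.
by move=> /andP[/eqP -> /eqP ->].
Qed.

End Scalars.

(** * The real inner product and the Cauchy-Schwarz inequality *)

Section RealInner.
Context {R : realType} {k : scalar_kind} {H : hilbertType R k}.
Implicit Types (x y z : H) (c e : R).

(** A symmetric real bilinear form inducing the same norm, so that all estimates take place in
    [R]. *)
Definition rdot x y : R := re_scalar <[x, y]>.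

Lemma rdotC x y : rdot x y = rdot y x.
Proof. by rewrite /rdot (hermC inner x y) expr0 mul1r re_conj_scalar. Qed.

Lemma rdotDl x y z : rdot (x + y) z = rdot x z + rdot y z.
Proof. by rewrite /rdot linearDl re_scalarD. Qed.

Lemma rdotZl c x y : rdot (of_real k c *: x) y = c * rdot x y.
Proof. by rewrite /rdot linearZl_LR re_scalarM. Qed.

Lemma rdot0l x : rdot 0 x = 0.
Proof. by apply: (addrI (rdot 0 x)); rewrite -rdotDl !addr0. Qed.

Lemma rdotNl x y : rdot (- x) y = - rdot x y.
Proof. by apply: (addrI (rdot x y)); rewrite -rdotDl !subrr rdot0l. Qed.

Lemma rdotBl x y z : rdot (x - y) z = rdot x z - rdot y z.
Proof. by rewrite rdotDl rdotNl. Qed.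

Lemma rdotDr x y z : rdot z (x + y) = rdot z x + rdot z y.
Proof. by rewrite rdotC rdotDl !(rdotC z). Qed.

Lemma rdotBr x y z : rdot z (x - y) = rdot z x - rdot z y.
Proof. by rewrite rdotC rdotBl !(rdotC z). Qed.

Lemma rdotZr c x y : rdot x (of_real k c *: y) = c * rdot x y.
Proof. by rewrite rdotC rdotZl rdotC. Qed.

Lemma rdot_suml (I : Type) (r : seq I) (F : I -> H) x :
  rdot (\sum_(i <- r) F i) x = \sum_(i <- r) rdot (F i) x.
Proof.
by elim/big_rec2 : _ => [|i _ y _ <-]; rewrite ?rdot0l ?rdotDl.
Qed.

Lemma norm_of_rnorm x : `|x| = of_real k (rnorm x).
Proof. by rewrite of_real_re. Qed.

Lemma rnorm_ge0 x : 0 <= rnorm x.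
Proof.
by rewrite leNgt -(ltr_of_real (k := k)) -norm_of_rnorm of_real0 normr_lt0.
Qed.

Lemma rdotxx x : rdot x x = rnorm x ^+ 2.
Proof. by rewrite /rdot -inner_norm norm_of_rnorm -of_realX of_realK. Qed.

Lemma rdotxx_ge0 x : 0 <= rdot x x.
Proof. by rewrite rdotxx sqr_ge0. Qed.

Lemma rnorm_eq0 x : rnorm x = 0 -> x = 0.
Proof.
by move=> x0; apply/normr0_eq0; rewrite norm_of_rnorm x0 of_real0.
Qed.

Lemma rdot_le x y : rdot x y <= rnorm x * rnorm y.
Proof.
have [/rnorm_eq0 ->|y0] := eqVneq (rnorm y) 0.
  by rewrite rdotC rdot0l mulr_ge0 ?rnorm_ge0.
have {}y0 : 0 < rnorm y ^+ 2 by rewrite exprn_gt0// lt_def y0 rnorm_ge0.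
(* The squared norm of this vector is |y|^2 (|x|^2 |y|^2 - (rdot x y)^2). *)
have := rdotxx_ge0 (of_real k (rnorm y ^+ 2) *: x - of_real k (rdot x y) *: y).
rewrite !(rdotBl, rdotBr, rdotZl, rdotZr) (rdotC y) !rdotxx => h.
have [xy0|/ltW xy0] := leP (rdot x y) 0.
  by rewrite (le_trans xy0)// mulr_ge0 ?rnorm_ge0.
rewrite -ler_sqr ?nnegrE ?mulr_ge0 ?rnorm_ge0// exprMn -subr_ge0.
rewrite -(pmulr_rge0 _ y0); apply: le_trans h _.
by rewrite le_eqVlt; apply/orP; left; apply/eqP; ring.
Qed.

Lemma rnormD x y : rnorm (x + y) <= rnorm x + rnorm y.
Proof.
rewrite -ler_sqr ?nnegrE ?addr_ge0 ?rnorm_ge0// -rdotxx.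
rewrite rdotDl !rdotDr (rdotC y x) !rdotxx sqrrD.
by have := rdot_le x y; lra.
Qed.

Lemma rnormN x : rnorm (- x) = rnorm x.
Proof. by rewrite /rnorm normrN. Qed.

Lemma normr_lt_of_real x e : (`|x| < of_real k e) = (rnorm x < e).
Proof. by rewrite norm_of_rnorm ltr_of_real. Qed.

End RealInner.

(** * Orthogonal projections onto closed subspaces *)

Section Projection.
Context {R : realType} {k : scalar_kind} {H : hilbertType R k}.
Implicit Types (x y z : H) (e : R) (M : set H).

Lemma cauchy_rnorm (F : set_system H) : ProperFilter F ->
  (forall e, 0 < e -> exists2 A, F A & forall y z, A y -> A z ->
     rnorm (y - z) < e) -> cvg F.
Proof.
move=> PF hF; apply: cauchy_cvg; apply/cauchy_exP => e e0.
have ee := of_real_re _ (ltW e0).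
have [|A FA hA] := hF (re_scalar e).
  by rewrite -(ltr_of_real (k := k)) ee of_real0.
have [y Ay] := filter_ex FA; exists y.
apply: filterS FA => z Az; rewrite -ball_normE /ball_ /= -ee normr_lt_of_real.
exact: hA.
Qed.

Lemma cvg_rnorm_lt {T : Type} {F : set_system T} {FF : Filter F}
    (u : T -> H) l e :
  u @ F --> l -> 0 < e -> \forall t \near F, rnorm (l - u t) < e.
Proof.
move=> /cvgrPdist_lt ul e0.
have e0' : 0 < of_real k e by rewrite -of_real0 ltr_of_real.
by apply: filterS (ul _ e0') => t; rewrite norm_of_rnorm ltr_of_real.
Qed.

(** The point of [M] nearest to [x] is the limit of the filter of near-minimizers of the squared
    distance; varying it inside [M] gives orthogonality. *)
Lemma proj_subproof M x : closed_subspace M ->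
  exists y, M y /\ forall z, M z -> <[x - y, z]> = 0.
Proof.
move=> [Mc M0 ML].
have MD y z : M y -> M z -> M (y + z) by rewrite -{2}[y]scale1r; exact: ML.
have MZ c y : M y -> M (c *: y).
  by move=> My; rewrite -[_ *: _]addr0; exact: ML.
pose D := [set rdot (x - y) (x - y) | y in M].
have D_lb : has_inf D.
  split; first by exists (rdot (x - 0) (x - 0)), 0.
  by exists 0 => _ [y _ <-]; exact: rdotxx_ge0.
pose d := inf D.
have dM y : M y -> d <= rdot (x - y) (x - y).
  by move=> My; apply: ge_inf; [exact: D_lb.2|exists y].
pose near_min e := [set y | M y /\ rdot (x - y) (x - y) < d + e].
have near_min_ex e : 0 < e -> exists y, near_min e y.
  by move=> e0; have [_ [y My <-] ?] := inf_adherent e0 D_lb; exists y.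
pose F := filter_from [set e : R | 0 < e] near_min.
have PF : ProperFilter F.
  apply: filter_from_proper; last by move=> e /near_min_ex.
  apply: filter_from_filter; first by exists 1 => /=.
  move=> a b /= a0 b0; exists (Num.min a b); first by rewrite /= lt_min a0.
  move=> y [My]; rewrite -ltrBlDl lt_min => /andP[].
  by rewrite !ltrBlDl; split.
(* The parallelogram law makes the near-minimizers a Cauchy filter. *)
have : cvg F.
  apply: cauchy_rnorm => e e0; pose e' := e ^+ 2 / 4.
  have e'0 : 0 < e' by rewrite divr_gt0// exprn_gt0.
  exists (near_min e'); first by exists e'.
  move=> y z [My hy] [Mz hz].
  rewrite -ltr_sqr ?nnegrE ?rnorm_ge0 ?(ltW e0)// -rdotxx.
  (* The midpoint of [y] and [z] lies in [M], hence |y - z|^2 < 4 (d + e') - 4 d = e^2. *)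
  move: hy hz (dM _ (MZ (of_real k 2^-1) _ (MD _ _ My Mz))).
  rewrite !(rdotBl, rdotBr, rdotDl, rdotDr, rdotZl, rdotZr).
  rewrite (rdotC y x) (rdotC z x) (rdotC z y) /e'; lra.
move=> /cvg_ex [y Fy]; exists y.
have My : M y.
  by apply: (@closed_cvg _ _ F _ id M Mc _ y Fy); exists 1 => //= z [].
have d_ge0 : 0 <= d.
  by apply: lb_le_inf; [exact: D_lb.1|move=> _ [z _ <-]; exact: rdotxx_ge0].
have yd : rdot (x - y) (x - y) <= d.
  rewrite rdotxx -[leRHS]sqr_sqrtr// ler_sqr ?nnegrE ?rnorm_ge0 ?sqrtr_ge0//.
  (* Otherwise let [e] be half the gap between |x - y| and sqrt d. Some [z] has |x - z| < sqrt d + e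
     and |y - z| < e, whence |x - y| < sqrt d + 2 e = |x - y|. *)
  rewrite leNgt; apply/negP => lt_d.
  pose e := (rnorm (x - y) - Num.sqrt d) / 2.
  have e0 : 0 < e by rewrite divr_gt0// subr_gt0.
  have [z [[_ hz] yz]] : exists z,
      near_min ((Num.sqrt d + e) ^+ 2 - d) z /\ rnorm (y - z) < e.
    apply: (@filter_ex _ F); apply: filterI; last first.
      exact: (@cvg_rnorm_lt _ F _ id y e Fy e0).
    exists ((Num.sqrt d + e) ^+ 2 - d) => //=.
    rewrite -{2}[d]sqr_sqrtr// subr_gt0 ltr_sqr ?ltrDl//
      nnegrE ?addr_ge0 ?sqrtr_ge0//.
    exact: ltW.
  move: hz; rewrite (addrC d) subrK rdotxx ltr_sqr ?nnegrE ?rnorm_ge0//; last first.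
    by rewrite addr_ge0 ?sqrtr_ge0// ltW.
  have := rnormD (x - z) (z - y); rewrite addrA subrK -(rnormN (z - y)) opprB.
  by move: yz; rewrite /e; lra.
split=> // z Mz; pose c := <[x - y, z]>.
(* Replacing [z] by [c *: z] reduces the claim to the real part. *)
apply: re_conj_mulr_eq0.
have -> : conj_scalar k c * c = <[x - y, c *: z]> by rewrite linearZr_LR.
move: (c *: z) (MZ c _ Mz) => {c Mz} {}z Mz; rewrite -/(rdot (x - y) z).
(* Minimality of [y] against the competitor y + t z. *)
have h t : 0 <= t ^+ 2 * rdot z z - 2 * t * rdot (x - y) z.
  have := le_trans yd (dM _ (MD _ _ My (MZ (of_real k t) _ Mz))).
  rewrite opprD addrA; move: (x - y) => a.
  by rewrite !(rdotBl, rdotBr, rdotZl, rdotZr) (rdotC z a); lra.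
have z0 := rdotxx_ge0 z.
(* The added 1 keeps the denominator positive even if z = 0. *)
have := h (rdot (x - y) z / (rdot z z + 1)).
move: (rdot _ z) (rdot z z) z0 => a b b0.
have b1 : 0 < b + 1 by lra.
have -> : (a / (b + 1)) ^+ 2 * b - 2 * (a / (b + 1)) * a =
          - ((a / (b + 1)) ^+ 2 * (b + 2)).
  by field; rewrite gt_eqF.
rewrite oppr_ge0 pmulr_lle0; last lra.
move=> a0; apply/eqP; have : (a / (b + 1)) ^+ 2 == 0.
  by rewrite eq_le a0 sqr_ge0.
by rewrite sqrf_eq0 mulf_eq0 invr_eq0 (gt_eqF b1) orbF.
Qed.

Lemma projP M x : closed_subspace M ->
  M (Defs.proj M x) /\ forall z, M z -> <[x - Defs.proj M x, z]> = 0.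
Proof. by move=> Mc; apply: (xgetPex 0 (proj_subproof M x Mc)). Qed.

(** Both sides equal the real inner product of the two projections. *)
Lemma rdot_proj M x y : closed_subspace M ->
  rdot (Defs.proj M x) y = rdot x (Defs.proj M y).
Proof.
move=> Mc; have [Mx ox] := projP M x Mc; have [My oy] := projP M y Mc.
have /eqP := congr1 re_scalar (ox _ My); have /eqP := congr1 re_scalar (oy _ Mx).
rewrite -!/(rdot _ _) !rdotBl !(rdotC y) (rdotC (Defs.proj M y)).
by rewrite re_scalar0 !subr_eq0 => /eqP -> /eqP ->.
Qed.

End Projection.

(** * Adjoints *)

Lemma adjP {R : realType} {k : scalar_kind} {H G : hilbertType R k}
    (A : {linear H -> G}) (y : G) :
  (forall z, <[A z, y]> = <[z, adj A y]>) \/ adj A y = 0.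
Proof. by rewrite /adj; case: xgetP => [x _ /= Ax|_]; [left|right]. Qed.

(* Only an inequality is needed, and it also holds when an adjoint takes its
   default value 0; this makes the Riesz representation theorem unnecessary. *)
Lemma rdot_adj_proj_adj_le {R : realType} {k : scalar_kind}
    {H G : hilbertType R k} (T : {linear H -> H}) (A : {linear H -> G})
    (M : set H) (y : G) (g : H) :
  closed_subspace M ->
  rdot (adj T (Defs.proj M (adj A y))) g <= rnorm y * rnorm (A (Defs.proj M (T g))).
Proof.
move=> Mc; have pos : 0 <= rnorm y * rnorm (A (Defs.proj M (T g))).
  by rewrite mulr_ge0 ?rnorm_ge0.
have [adjT|->] := adjP T (Defs.proj M (adj A y)); last by rewrite rdot0l.
rewrite rdotC /rdot -adjT -/(rdot _ _) -rdot_proj//.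
have [adjA|->] := adjP A y; last by rewrite rdotC rdot0l.
by rewrite /rdot -adjA -/(rdot _ _) mulrC rdot_le.
Qed.

(** * Unordered sums of nonnegative reals *)

Lemma big_fset_subset (V : nmodType) (I : choiceType) (F : I -> V)
  (A B : {fset I}) : (A `<=` B)%fset ->
  \sum_(i <- B) F i = \sum_(i <- A) F i + \sum_(i <- (B `\` A)%fset) F i.
Proof.
move=> AB; rewrite (big_fsetID _ (mem A)) /=; congr (_ + _).
  apply: eq_fbigl => i; rewrite !inE /=; apply: andb_idl; exact: (fsubsetP AB).
by apply: eq_fbigl => i; rewrite !inE /= andbC.
Qed.

Section NonnegativeSums.
Context {R : realType} {I : choiceType} (c : I -> R) (B : R).
Hypothesis c_ge0 : forall i, 0 <= c i.
Hypothesis c_le : (\esum_(i in [set: I]) (c i)%:E <= B%:E)%E.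

Let S := fine (\esum_(i in [set: I]) (c i)%:E)%E.

Lemma esum_fin_num : (\esum_(i in [set: I]) (c i)%:E)%E = S%:E.
Proof.
rewrite /S fineK// ge0_fin_numE ?(le_lt_trans c_le) ?ltry//.
by apply: esum_ge0 => i _; rewrite lee_fin.
Qed.

Lemma sum_le_esum (A : {fset I}) : \sum_(i <- A) c i <= S.
Proof.
rewrite -lee_fin -esum_fin_num -sumEFin; apply: esum_ge.
exists [set` A]; first by split=> //; exact: finite_fset.
by rewrite fsbig_finite ?set_fsetK//; exact: finite_fset.
Qed.

(** Some finite partial sum is within [e] of the supremum, and no larger finite set can exceed the
    supremum. *)
Lemma esum_tail e : 0 < e -> exists A : {fset I}, forall A' : {fset I},
  (A `<=` A')%fset -> \sum_(i <- (A' `\` A)%fset) c i < e.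
Proof.
move=> e0; have fS : (\esum_(i in [set: I]) (c i)%:E)%E \is a fin_num.
  by rewrite esum_fin_num.
have [_ [X [finX _] <-]] := ub_ereal_sup_adherent e0 fS.
rewrite -/(esum _ _) esum_fin_num fsbig_finite//= sumEFin -EFinB lte_fin => hX.
exists (fset_set X) => A' XA'.
have := sum_le_esum A'; rewrite (big_fset_subset _ _ _ _ _ XA'); move: hX => /=; lra.
Qed.

End NonnegativeSums.

(** * Unconditional convergence of vector series *)

Section UnconditionalConvergence.
Context {R : realType} {k : scalar_kind} {H : hilbertType R k} {I : choiceType}.
Implicit Types (A B : {fset I}).
Import summability.
#[local] Existing Instance totally_filter.

Lemma partial_sumE (t : I -> H) A : partial_sum t A = \sum_(i <- A) t i.
Proof. by rewrite /partial_sum big_seq_fsetE. Qed.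

(** The scalar series has small tails, and the square-norm bound on finite sums carries this over to
    [t]. Tails of norm below e / 2 put any two late partial sums within [e]. *)
Lemma cvg_partial_sum (t : I -> H) (c : I -> R) (B D : R) :
  (forall i, 0 <= c i) -> (\esum_(i in [set: I]) (c i)%:E <= B%:E)%E ->
  0 < D -> (forall A, rnorm (\sum_(i <- A) t i) ^+ 2 <= D * \sum_(i <- A) c i) ->
  cvg (partial_sum t @ totally).
Proof.
move=> c0 cB D0 hD; apply: cauchy_rnorm => e e0.
have e'0 : 0 < (e / 2) ^+ 2 / D by rewrite divr_gt0// exprn_gt0// divr_gt0.
have [A hA] := esum_tail c B c0 cB _ e'0.
have tail A' : (A `<=` A')%fset ->
    rnorm (\sum_(i <- A') t i - \sum_(i <- A) t i) < e / 2.
  move=> AA'; rewrite (big_fset_subset _ _ _ _ _ AA') [X in X - _]addrC addrK.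
  rewrite -ltr_sqr ?nnegrE ?rnorm_ge0 ?divr_ge0 ?(ltW e0)//.
  by rewrite (le_lt_trans (hD _))// mulrC -ltr_pdivlMr// hA.
exists [set y | rnorm (y - \sum_(i <- A) t i) < e / 2].
  by exists A => // A' /=; rewrite partial_sumE; exact: tail.
move=> y z /= hy hz; pose s := \sum_(i <- A) t i.
have := rnormD (y - s) (s - z); rewrite addrA subrK -(rnormN (s - z)) opprB.
by move: hy hz; rewrite -/s; lra.
Qed.

(** A partial sum within e / (|x| + 1) of the limit changes the inner product with [x] by at most
    [e], by Cauchy-Schwarz. *)
Lemma rdot_sum_le (t : I -> H) (x : H) b : cvg (partial_sum t @ totally) ->
  (forall A, rdot (\sum_(i <- A) t i) x <= b) -> rdot (sum t) x <= b.
Proof.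
move=> cvg_t hb; apply/ler_addgt0Pr => e e0.
have e'0 : 0 < e / (rnorm x + 1) by rewrite divr_gt0// ltr_wpDl ?rnorm_ge0.
have [A hA] := filter_ex
  (@cvg_rnorm_lt _ _ _ _ _ _ (partial_sum t) (sum t) _ cvg_t e'0).
rewrite -[sum t](subrK (partial_sum t A)) rdotDl addrC lerD//.
  by rewrite partial_sumE.
rewrite (le_trans (rdot_le _ _))//.
rewrite (le_trans (ler_wpM2r (rnorm_ge0 _) (ltW hA)))//.
rewrite mulrAC ler_pdivrMr ?ltr_wpDl ?rnorm_ge0// ler_pM2l//.
by rewrite lerDl.
Qed.

End UnconditionalConvergence.

(** * Estimates for the frame operator of a Bessel pair *)

Section FramePair.
Context {R : realType} {k : scalar_kind} {H : hilbertType R k}.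
Context {I : choiceType} {HI : I -> hilbertType R k}.
Implicit Types (T U : {linear H -> H}) (M W V : I -> set H) (A : {fset I}).
Implicit Types (Theta Lambda Gamma : forall j, {linear H -> HI j}).
Implicit Types (u w v : I -> R) (f g : H).

Definition coef T M Theta u f j : R :=
  u j * rnorm (Theta j (Defs.proj (M j) (T f))).

Lemma controlled_sumE T M Theta u f :
  controlled_sum T M Theta u f =
  (\esum_(j in [set: I]) (coef T M Theta u f j ^+ 2)%:E)%E.
Proof.
by apply: eq_esum => j _; rewrite -/(rdot _ _) rdotxx /coef exprMn.
Qed.

Context {T U : {linear H -> H}} {W V : I -> set H}.
Context {Lambda Gamma : forall j, {linear H -> HI j}} {w v : I -> R}.
Context {D1 D2 : R}.
Hypothesis bessel_T : controlled_gfusion_bessel T W Lambda w D1.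
Hypothesis bessel_U : controlled_gfusion_bessel U V Gamma v D2.

Let term f j := of_real k (v j * w j) *:
  adj T (Defs.proj (W j) (adj (Lambda j) (Gamma j (Defs.proj (V j) (U f))))).

(** Passing to real values loses nothing, since the Bessel bounds make both sums finite. *)
Let sumT f := fine (controlled_sum T W Lambda w f).
Let sumU f := fine (controlled_sum U V Gamma v f).

Lemma rdot_term_sum_le f g A s : 0 < s ->
  2 * rdot (\sum_(j <- A) term f j) g <=
  s * (\sum_(j <- A) coef U V Gamma v f j ^+ 2) +
  s^-1 * (\sum_(j <- A) coef T W Lambda w g j ^+ 2).
Proof.
move=> s0; have [famT _ _] := bessel_T; have [famU _ _] := bessel_U.
rewrite rdot_suml !mulr_sumr -big_split /=; apply: ler_sum => j _.
have [Wc _ w0] := famT j; have [_ _ v0] := famU j.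
set a := coef _ _ _ _ _ _; set b := coef _ _ _ _ _ _.
apply: (@le_trans _ _ (2 * (a * b))).
  rewrite ler_pM2l// rdotZl /a /b /coef mulrACA ler_pM2l ?mulr_gt0//.
  exact: rdot_adj_proj_adj_le.
rewrite -subr_ge0.
(* Weighted AM-GM, as a completed square. *)
have -> : s * a ^+ 2 + s^-1 * b ^+ 2 - 2 * (a * b) = s^-1 * (s * a - b) ^+ 2.
  by field; rewrite gt_eqF.
by rewrite mulr_ge0 ?sqr_ge0// invr_ge0 ltW.
Qed.

Lemma cvg_frame_operator f :
  cvg (summability.partial_sum (term f) @ summability.totally).
Proof.
have [_ D1_gt0 leT] := bessel_T; have [_ _ leU] := bessel_U.
apply: (cvg_partial_sum (term f) (fun j => coef U V Gamma v f j ^+ 2)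
    (D2 * rnorm f ^+ 2) D1) => //.
- by move=> j; exact: sqr_ge0.
- by rewrite -controlled_sumE.
move=> A; set g := \sum_(i <- A) term f i.
(* The left side is 2 |g|^2, and the Bessel bound makes the last term at most |g|^2. Absorbing it
   leaves |g|^2 bounded by [D1] times the finite sum for [U]. *)
have := rdot_term_sum_le f g A _ D1_gt0; rewrite -/g rdotxx.
have : \sum_(j <- A) coef T W Lambda w g j ^+ 2 <= D1 * rnorm g ^+ 2.
  have := leT g; rewrite controlled_sumE => leTg.
  have h0 j : 0 <= coef T W Lambda w g j ^+ 2 by exact: sqr_ge0.
  apply: le_trans (sum_le_esum _ _ h0 leTg A) _.
  by rewrite -lee_fin -(esum_fin_num _ _ h0 leTg).
rewrite -(ler_pM2l (_ : 0 < D1^-1)) ?invr_gt0// mulKf ?gt_eqF//.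
lra.
Qed.

Lemma rdot_frame_operator_le f g s : 0 < s ->
  2 * rdot (frame_operator T W Lambda w U V Gamma v f) g <=
  s * sumU f + s^-1 * sumT g.
Proof.
move=> s0; have [_ _ leT] := bessel_T; have [_ _ leU] := bessel_U.
rewrite mulrC -ler_pdivlMr//; apply: rdot_sum_le; first exact: cvg_frame_operator.
move=> A; rewrite ler_pdivlMr// mulrC.
apply: le_trans (rdot_term_sum_le f g A _ s0) _.
have h0 X Y (Z : forall j, {linear H -> HI j}) t x j : 0 <= coef X Y Z t x j ^+ 2.
  exact: sqr_ge0.
rewrite /sumU /sumT !controlled_sumE; apply: lerD.
  rewrite ler_pM2l//; apply: (sum_le_esum _ (D2 * rnorm f ^+ 2)) => //.
  by rewrite -controlled_sumE.
rewrite ler_pM2l ?invr_gt0//; apply: (sum_le_esum _ (D1 * rnorm g ^+ 2)) => //.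
by rewrite -controlled_sumE.
Qed.

End FramePair.

(** * Lower frame bounds and conclusion *)

Lemma bessel_frame {R : realType} {k : scalar_kind} {H : hilbertType R k}
    {I : choiceType} {HI : I -> hilbertType R k} {T : {linear H -> H}}
    {M : I -> set H} {Theta : forall j, {linear H -> HI j}} {u : I -> R}
    {a b : R} :
  controlled_gfusion_bessel T M Theta u b -> 0 < a ->
  (forall f, a * rnorm f ^+ 2 <= fine (controlled_sum T M Theta u f)) ->
  controlled_gfusion_frame T M Theta u.
Proof.
(* The upper bound a + b ensures a <= a + b even when H = 0, where the inequalities do not compare
   [a] with [b]. *)
move=> [fam b0 le_b] a0 le_a; split=> //; exists a, (a + b).
split=> // [|f]; first by rewrite lerDl ltW.
have fin : controlled_sum T M Theta u f \is a fin_num.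
  rewrite controlled_sumE; move: (le_b f); rewrite controlled_sumE => le_bf.
  by rewrite (esum_fin_num _ _ _ le_bf)// => j; exact: sqr_ge0.
split; first by rewrite -(fineK fin) lee_fin.
apply: le_trans (le_b f) _; rewrite lee_fin ler_wpM2r ?sqr_ge0//.
by rewrite lerDr ltW.
Qed.

Theorem theorem4p6 (R : realType) (k : scalar_kind) (H : hilbertType R k)
    (Hsep : separable H) (J : set int) (HJ : J -> hilbertType R k)
    (W V : J -> set H) (Lambda Gamma : forall j : J, {linear H -> HJ j})
    (w v : J -> R) (T U : {linear H -> H}) (D1 D2 lambda : R) :
  GB T -> GB U ->
  controlled_gfusion_bessel T W Lambda w D1 ->
  controlled_gfusion_bessel U V Gamma v D2 ->
  0 < lambda -> lambda < 1 ->
  (forall f : H,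
     rnorm (f - frame_operator T W Lambda w U V Gamma v f) <= lambda * rnorm f) ->
  controlled_gfusion_frame T W Lambda w /\ controlled_gfusion_frame U V Gamma v.
Proof.
move=> _ _ bT bU _ lambda_lt1 hS.
have [_ D1_gt0 _] := bT; have [_ D2_gt0 _] := bU.
have mu0 : 0 < 1 - lambda by rewrite subr_gt0.
have le_fine X Y (Z : forall j, {linear H -> HJ j}) u D f :
    controlled_gfusion_bessel X Y Z u D ->
    fine (controlled_sum X Y Z u f) <= D * rnorm f ^+ 2.
  move=> [_ _ /(_ f)]; rewrite controlled_sumE => le_f.
  by rewrite -lee_fin -(esum_fin_num _ _ _ le_f)// => j; exact: sqr_ge0.
have key f s : 0 < s -> 2 * ((1 - lambda) * rnorm f ^+ 2) <=
    s * fine (controlled_sum U V Gamma v f) +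
    s^-1 * fine (controlled_sum T W Lambda w f).
  move=> s0; apply: le_trans (rdot_frame_operator_le bT bU f f s s0).
  rewrite ler_pM2l//; set Sf := frame_operator _ _ _ _ _ _ _ _ _.
  (* Cauchy-Schwarz and the hypothesis give |f|^2 - Re <Sf, f> <= lambda |f|^2. *)
  have := rdot_le (f - Sf) f; rewrite rdotBl rdotxx.
  have := ler_wpM2r (rnorm_ge0 f) (hS f); rewrite -/Sf; lra.
(* Shared arithmetic: [N] is |f|^2, [x] the sum with Bessel bound [D], [y] the sum to be bounded
   below. The weight (1 - lambda) / D makes the [x] term at most half of the left side. *)
have low (D N x y : R) : 0 < D -> x <= D * N ->
    2 * ((1 - lambda) * N) <= (1 - lambda) / D * x + ((1 - lambda) / D)^-1 * y ->
    (1 - lambda) ^+ 2 / D * N <= y.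
  move=> D0 xN; have s0 : 0 < (1 - lambda) / D by rewrite divr_gt0.
  have := ler_wpM2l (ltW s0) xN; rewrite [_ * (D * N)]mulrA divfK ?gt_eqF// => h1 h2.
  have : (1 - lambda) * N <= ((1 - lambda) / D)^-1 * y by lra.
  rewrite invf_div [leRHS]mulrAC ler_pdivlMr// => h3.
  by rewrite mulrAC ler_pdivrMr// (mulrC y) expr2 mulrAC.
split.
- apply: (bessel_frame (a := (1 - lambda) ^+ 2 / D2) bT).
    by rewrite divr_gt0// exprn_gt0.
  move=> f; apply: (low _ _ _ _ D2_gt0 (le_fine _ _ _ _ _ f bU)).
  by apply: key; rewrite divr_gt0.
apply: (bessel_frame (a := (1 - lambda) ^+ 2 / D1) bU).
  by rewrite divr_gt0// exprn_gt0.
move=> f; apply: (low _ _ _ _ D1_gt0 (le_fine _ _ _ _ _ f bT)).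
(* The two sums have exchanged roles, so [key] is used with the inverse weight. *)
rewrite [leRHS]addrC -[X in _ + X * _]invrK.
by apply: key; rewrite invr_gt0 divr_gt0.
Qed.
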